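(* Let $G$ be a finite abelian group and let $n\geq 1$. Then the group $T_n(\mathbb{Z}G)$ satisfies a positive generalized identity if and only if $G$ has exponent $1$, $2$, $3$, $4$, or $6$.
   Context: $\mathbb{Z}G$ is the integral group ring of $G$. For a commutative ring $R$, $T_n(R)$ is the group of upper triangular $n\times n$ matrices over $R$ with diagonal entries in the unit group $R^\times$. For a group $H$ write $h^x=x^{-1}hx$. A group $H$ satisfies a positive generalized identity if there exist $k\geq 1$ and fixed elements $h_1,\dots,h_k\in H$ such that $x^{h_1}x^{h_2}\cdots x^{h_k}=1$ for all $x\in H$. *)

(* Defs.v *)
From HB Require Import structures.
From mathcomp Require Import all_boot all_order all_algebra all_fingroup.
From mathcomp Require Import all_solvable.
From mathcomp Require Import boolp.

Set Implicit Arguments.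
Unset Strict Implicit.
Unset Printing Implicit Defensive.

Import GRing.Theory.

Local Open Scope ring_scope.

(* The element \sum_g a_g g of Z[gT] is encoded by its coefficients g |-> a_g.
   The proof that gT is abelian is a phantom parameter of the type; it is what
   allows the ring structure to be declared commutative. The ring structure
   below is the convolution one: it is not the pointwise ring structure that
   MathComp puts on {ffun gT -> int} itself. *)
Definition zgring (gT : finGroupType) (abG : abelian [set: gT]) : predArgType :=
  {ffun gT -> int}.

Definition zgcoef (gT : finGroupType) (abG : abelian [set: gT])
  (a : zgring abG) : {ffun gT -> int} := a.

Coercion zgcoef : zgring >-> finfun_of.

Section IntegralGroupRing.

Variables (gT : finGroupType) (abG : abelian [set: gT]).

HB.instance Definition _ := GRing.Zmodule.on (zgring abG).

Definition zgbasis (g : gT) : zgring abG := [ffun h => (h == g)%:R].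

Definition zgmul (a b : zgring abG) : zgring abG :=
  [ffun g => \sum_h a h * b (h^-1 * g)%g].

Let mulgCT (x y : gT) : (x * y = y * x)%g.
Proof. by apply: (centsP abG); rewrite inE. Qed.

Fact zgmulA : associative zgmul.
Proof.
move=> a b c; apply/ffunP=> g; rewrite !ffunE.
under eq_bigr => h _ do rewrite ffunE mulr_sumr.
under [RHS]eq_bigr => k _ do rewrite ffunE mulr_suml.
rewrite [RHS]exchange_big; apply: eq_bigr => h _ /=.
rewrite (reindex_inj (mulgI h^-1%g)); apply: eq_bigr => k _ /=.
by rewrite mulrA invMg invgK -mulgA (mulgA h) mulgV mul1g.
Qed.

Fact zgmulC : commutative zgmul.
Proof.
move=> a b; apply/ffunP=> g; rewrite !ffunE.
rewrite (reindex_inj (inj_comp (mulIg g) invg_inj)); apply: eq_bigr => h _ /=.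
by rewrite mulrC invMg invgK -mulgA (mulgCT h) mulKg.
Qed.

Fact zgmul1 : left_id (zgbasis 1%g) zgmul.
Proof.
move=> a; apply/ffunP=> g; rewrite ffunE (bigD1 1%g) //= ffunE eqxx mul1r.
rewrite invg1 mul1g big1 ?addr0 // => h /negbTE hN1.
by rewrite ffunE hN1 mul0r.
Qed.

Fact zgmulDl : left_distributive zgmul +%R.
Proof.
move=> a b c; apply/ffunP=> g; rewrite !ffunE -big_split.
by apply: eq_bigr => h _; rewrite ffunE mulrDl.
Qed.

Fact zg1_neq0 : zgbasis 1%g != 0.
Proof. by apply/eqP=> /ffunP/(_ 1%g); rewrite !ffunE eqxx. Qed.

HB.instance Definition _ := GRing.Zmodule_isComNzRing.Build (zgring abG)
  zgmulA zgmulC zgmul1 zgmulDl zg1_neq0.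

Definition zgunit : {pred zgring abG} := fun a => `[< exists b, b * a = 1 >].

Definition zginv (a : zgring abG) : zgring abG :=
  if pselect (exists b, b * a = 1) is left ab then projT1 (cid ab) else a.

Fact zgmulV : {in zgunit, left_inverse 1 zginv *%R}.
Proof.
move=> a /asboolP ua; rewrite /zginv; case: pselect => // ua'.
exact: (projT2 (cid ua')).
Qed.

Fact zgunitPl (a b : zgring abG) : b * a = 1 -> zgunit a.
Proof. by move=> ba1; apply/asboolP; exists b. Qed.

Fact zginv_out : {in [predC zgunit], zginv =1 id}.
Proof.
move=> a /negP ua; rewrite /zginv; case: pselect => // ua'.
by case: ua; apply/asboolP.
Qed.

HB.instance Definition _ := GRing.ComNzRing_hasMulInverse.Build (zgring abG)
  zgmulV zgunitPl zginv_out.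

Lemma zgmulE (a b : zgring abG) (g : gT) :
  (a * b) g = \sum_h a h * b (h^-1 * g)%g.
Proof. by rewrite /zgcoef [LHS]ffunE. Qed.

Lemma zgbasisM (g h : gT) : zgbasis g * zgbasis h = zgbasis (g * h)%g.
Proof.
apply/ffunP=> k; rewrite [LHS]zgmulE (bigD1 g) //= !ffunE eqxx mul1r.
rewrite big1 ?addr0 => [|l /negbTE lNg]; last by rewrite ffunE lNg mul0r.
by rewrite -(inj_eq (mulgI g)) mulKVg.
Qed.

Lemma zgbasis1 : zgbasis 1%g = 1. Proof. by []. Qed.

End IntegralGroupRing.

Section TriangularGroup.

Variables (R : comUnitRingType) (n : nat).

Definition invertible_utrig : {pred 'M[R]_n} := fun A =>
  [forall i : 'I_n, forall j : 'I_n, (j < i)%N ==> (A i j == 0)]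
  && [forall i, A i i \is a GRing.unit].

Record triangular : predArgType :=
  Triangular {tri_mx :> 'M[R]_n; _ : tri_mx \in invertible_utrig}.

HB.instance Definition _ := [isSub for tri_mx].
HB.instance Definition _ := [Choice of triangular by <:].

Lemma invertible_utrigP (A : 'M[R]_n) :
  reflect ((forall i j : 'I_n, (j < i)%N -> A i j = 0)
           /\ (forall i, A i i \is a GRing.unit))
          (A \in invertible_utrig).
Proof.
apply: (iffP andP) => [[/forallP A0 /forallP Au] | [A0 Au]]; split=> //.
- by move=> i j ji; have /forallP/(_ j)/implyP/(_ ji)/eqP := A0 i.
- by apply/forallP=> i; apply/forallP=> j; apply/implyP=> /A0->.
- exact/forallP.
Qed.

Fact invertible_utrig1 : 1%:M \in invertible_utrig.
Proof.
apply/invertible_utrigP; split=> [i j ji | i]; rewrite mxE ?eqxx ?unitr1 //.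
by rewrite -val_eqE /= gtn_eqF.
Qed.

Fact invertible_utrigM (A B : 'M[R]_n) :
    A \in invertible_utrig -> B \in invertible_utrig ->
  A *m B \in invertible_utrig.
Proof.
move=> /invertible_utrigP[A0 Au] /invertible_utrigP[B0 Bu].
apply/invertible_utrigP; split=> [i j ji | i]; rewrite mxE.
  apply: big1 => k _; have [ki | ik] := ltnP k i; first by rewrite A0 ?mul0r.
  by rewrite B0 ?mulr0 ?(leq_trans ji ik).
rewrite (bigD1 i) //= big1 ?addr0 ?unitrM ?Au ?Bu // => k kNi.
case: (ltngtP k i) => [ki | ik | /val_inj ki]; last by rewrite ki eqxx in kNi.
  by rewrite A0 ?mul0r.
by rewrite B0 ?mulr0.
Qed.

Fact invertible_utrig_unit (A : 'M[R]_n) :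
  A \in invertible_utrig -> A \in unitmx.
Proof.
case/invertible_utrigP=> A0 Au; rewrite unitmxE -det_tr det_trig.
  by apply: rpred_prod => i _; rewrite mxE.
by apply/is_trig_mxP=> i j ij; rewrite mxE A0.
Qed.

Fact invertible_utrigV (A : 'M[R]_n) :
  A \in invertible_utrig -> invmx A \in invertible_utrig.
Proof.
move=> Atri; have uA := invertible_utrig_unit Atri.
have /invertible_utrigP[A0 Au] := Atri; set B := invmx A.
have BA : B *m A = 1%:M by rewrite mulVmx.
have B0 (i j : 'I_n) : (j < i)%N -> B i j = 0.
  have [m] := ubnP j; elim: m j => // m IHm j /ltnSE jm ji.
  have /matrixP/(_ i j) := BA; rewrite !mxE -val_eqE /= gtn_eqF //.
  rewrite (bigD1 j) //= big1 => [|k kNj].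
    by rewrite addr0 => BA0; apply: (mulIr (Au j)); rewrite mul0r.
  case: (ltngtP k j) => [kj | jk | /val_inj kj].
  - by rewrite IHm ?mul0r ?(leq_trans kj) ?(ltnW ji).
  - by rewrite A0 ?mulr0.
  - by rewrite kj eqxx in kNj.
apply/invertible_utrigP; split=> // i.
have /matrixP/(_ i i) := BA; rewrite !mxE eqxx (bigD1 i) //= big1 => [|k kNi].
  by rewrite addr0 => BA1; apply/unitrPr; exists (A i i).
case: (ltngtP k i) => [ki | ik | /val_inj ki].
- by rewrite B0 ?mul0r.
- by rewrite A0 ?mulr0.
- by rewrite ki eqxx in kNi.
Qed.

Definition tri_one : triangular := Triangular invertible_utrig1.
Definition tri_mul (A B : triangular) : triangular :=
  Triangular (invertible_utrigM (valP A) (valP B)).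
Definition tri_inv (A : triangular) : triangular :=
  Triangular (invertible_utrigV (valP A)).

Fact tri_mulA : associative tri_mul.
Proof. by move=> A B C; apply/val_inj/mulmxA. Qed.

Fact tri_mul1 : left_id tri_one tri_mul.
Proof. by move=> A; apply/val_inj/mul1mx. Qed.

Fact tri_mulr1 : right_id tri_one tri_mul.
Proof. by move=> A; apply/val_inj/mulmx1. Qed.

Fact tri_mulV : left_inverse tri_one tri_inv tri_mul.
Proof. by move=> A; apply/val_inj/mulVmx/invertible_utrig_unit/valP. Qed.

Fact tri_mulrV : right_inverse tri_one tri_inv tri_mul.
Proof. by move=> A; apply/val_inj/mulmxV/invertible_utrig_unit/valP. Qed.

HB.instance Definition _ := isGroup.Build triangular
  tri_mulA tri_mul1 tri_mulr1 tri_mulV tri_mulrV.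

Lemma tri_mxM (A B : triangular) : tri_mx (A * B)%g = tri_mx A *m tri_mx B.
Proof. by []. Qed.

Lemma tri_mx1 : tri_mx (1%g : triangular) = 1%:M. Proof. by []. Qed.

Lemma tri_mxV (A : triangular) : tri_mx A^-1%g = invmx (tri_mx A).
Proof. by []. Qed.

End TriangularGroup.

Notation "''T_' n ( R )" := (triangular R n)
  (at level 8, n at level 2, format "''T_' n ( R )") : type_scope.

Definition positive_generalized_identity (H : groupType) : Prop :=
  exists k : nat, (1 <= k)%N /\
    exists h : k.-tuple H,
      forall x : H, (\prod_(i < k) x ^ (tnth h i) = 1)%g.

(* Main.v *)
Require Import Defs.
From HB Require Import structures.
From mathcomp Require Import all_boot all_order all_algebra all_fingroup.
From mathcomp Require Import all_solvable all_field all_character ring zify.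

(* T_n(R) satisfies a positive generalized identity if and only if the units of
   R have bounded exponent. Scalar matrices give one direction. Conversely, if
   u^m = 1 for all units u, then A^m is unipotent for every A in T_n(R), and if
   the superdiagonals 1, ..., k-1 of a unipotent A vanish then the word A A^D,
   with D a diagonal matrix of signs such that D_i D_(i+k) = -1, also kills the
   k-th one.

   If the exponent of G divides 4 or 6, then chi(g) + chi(g)^* is rational for
   every character chi of G and every g in G, hence |chi(u)|^2 is a rational
   algebraic integer for every u in ZG. It is 1 when u is a unit, and Parseval's
   identity then shows that the squares of the coefficients of u sum to 1, so
   that u is a trivial unit (Higman). Otherwise G has an element g of order N
   with a residue a coprime to N and different from 1 and -1, and the Bass
   cyclic unit (1 + g + ... + g^(a-1))^m - q (1 + g + ... + g^(N-1)) has
   infinite order: at a primitive N-th root of unity z its value has absolute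
   value (|z^a - 1| / |z - 1|)^m, which is not 1. *)

Set Implicit Arguments.
Unset Strict Implicit.
Unset Printing Implicit Defensive.

Import Order.TTheory GRing.Theory Num.Theory.

Local Open Scope ring_scope.

(** * Positive words in a group *)

Section PositiveWords.

Variable H : groupType.

Definition positive_word (w : H -> H) : Prop :=
  exists2 s : seq H, (0 < size s)%N & forall x, w x = (\prod_(h <- s) x ^ h)%g.

Lemma positive_word_comp (v w : H -> H) :
  positive_word v -> positive_word w -> positive_word (v \o w).
Proof.
case=> s s_gt0 vE [t t_gt0 wE]; exists [seq (k * h)%g | h <- s, k <- t].
  by rewrite size_allpairs muln_gt0 s_gt0.
move=> x /=; rewrite vE wE big_allpairs_dep; apply: eq_bigr => h _.
by rewrite conjg_prod; apply: eq_bigr => k _; rewrite conjgM.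
Qed.

Lemma positive_word_expg m : (0 < m)%N -> positive_word (fun x => x ^+ m)%g.
Proof.
move=> m_gt0; exists (nseq m 1%g); first by rewrite size_nseq.
move=> x; elim: m {m_gt0} => [|m IHm]; first by rewrite big_nil expg0.
by rewrite /= big_cons conjg1 expgS IHm.
Qed.

Lemma positive_word_conj2 (d : H) : positive_word (fun x => x * x ^ d)%g.
Proof. by exists [:: 1; d]%g => // x; rewrite big_cons big_seq1 conjg1. Qed.

Lemma positive_word_identity (w : H -> H) :
  positive_word w -> (forall x, w x = 1%g) -> positive_generalized_identity H.
Proof.
case=> s s_gt0 wE w1; exists (size s); split=> //; exists (in_tuple s) => x.
by rewrite -[RHS](w1 x) wE [RHS](big_tnth _ _ s).
Qed.

End PositiveWords.

(** * Exponent of the units and positive identities of triangular groups *)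

Section Triangular.

Variables (R : comUnitRingType) (n : nat).
Implicit Types A B : 'T_n(R).

(** For k >= 1: [A] is unipotent and its superdiagonals 1, ..., k - 1 vanish. *)
Definition band (k : nat) A :=
  forall i j : 'I_n, (j < i + k)%N -> tri_mx A i j = (i == j)%:R.

(** Constant on blocks of length [k], so positions i and i + k carry opposite signs. *)
Definition signs (k : nat) : 'rV[R]_n := \row_i (-1) ^+ (i %/ k).

Lemma signs_tri k : diag_mx (signs k) \in @invertible_utrig R n.
Proof.
apply/invertible_utrigP; split=> [i j ji|i]; rewrite !mxE.
  by rewrite -val_eqE /= gtn_eqF.
by rewrite eqxx mulr1n rpredX // rpredN rpred1.
Qed.

Definition sign_tri k : 'T_n(R) := Triangular (signs_tri k).

Lemma sign_triV k : (sign_tri k)^-1%g = sign_tri k.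
Proof.
apply: (mulgI (sign_tri k)); rewrite mulgV; apply/val_inj/matrixP=> i j.
rewrite [RHS]/= mul_diag_mx !mxE; case: eqP => [->|_]; last by rewrite mulr0.
by rewrite !mulr1n -expr2 sqrr_sign.
Qed.

Lemma sign_triJ k A i j :
  tri_mx (A ^ sign_tri k)%g i j
    = (-1) ^+ (i %/ k) * tri_mx A i j * (-1) ^+ (j %/ k).
Proof.
rewrite conjgE sign_triV !tri_mxM /= mul_diag_mx mul_mx_diag !mxE.
by rewrite mulrA.
Qed.

(** For l other than i and j, either l < i + k and [A] vanishes at (i, l), or j <= l and [B]
    vanishes at (l, j). *)
Lemma bandM k A B (i j : 'I_n) :
    (0 < k)%N -> band k A -> band k B -> (j <= i + k)%N -> i != j ->
  tri_mx (A * B)%g i j = tri_mx A i j + tri_mx B i j.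
Proof.
move=> k_gt0 bA bB ij iNj; have bd (l : 'I_n) : (l < l + k)%N.
  by rewrite -[X in (X < _)%N]addn0 ltn_add2l.
rewrite tri_mxM mxE (bigD1 j) // (bigD1 i) //= big1 => [|l /andP[lNj lNi]].
  by rewrite addr0 (bB j j) // (bA i i) // !eqxx mul1r mulr1.
have [li|il] := ltnP l (i + k).
  by rewrite bA // eq_sym (negPf lNi) mul0r.
have lj : (j < l + k)%N by apply: leq_ltn_trans (leq_trans ij il) (bd l).
by rewrite bB // (negPf lNj) mulr0.
Qed.

Lemma band_conj k A : band k A -> band k (A ^ sign_tri k)%g.
Proof.
move=> bA i j ij; rewrite sign_triJ bA //.
case: eqP => [<-|_]; last by rewrite mulr0 mul0r.
by rewrite mulr1 -expr2 sqrr_sign.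
Qed.

(* The entries in position [(i, i + k)] add up in the product, and they change
   sign under conjugation by [sign_tri k]. *)
Lemma band_step k A :
  (0 < k)%N -> band k A -> band k.+1 (A * A ^ sign_tri k)%g.
Proof.
move=> k_gt0 bA i j; rewrite addnS ltnS => ij.
have bB := band_conj bA; case: (eqVneq i j) => [<-|iNj].
  rewrite tri_mxM mxE (bigD1 i) //= big1 => [|l lNi].
    by rewrite addr0 bA ?bB ?eqxx ?mulr1 // -{1}[val i]addn0 ltn_add2l.
  have [li|il] := ltnP l (i + k).
    by rewrite bA // eq_sym (negPf lNi) mul0r.
  by rewrite bB ?(negPf lNi) ?mulr0 // (leq_trans _ (leq_addr _ _)) //
             (leq_trans _ il) // -{1}[val i]addn0 ltn_add2l.
rewrite (bandM k_gt0 bA bB ij iNj).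
move: ij; rewrite leq_eqVlt => /orP[/eqP ij|ij].
  rewrite sign_triJ ij divnDr // divnn k_gt0 addn1 exprS mulN1r mulrN.
  by rewrite mulrAC -expr2 sqrr_sign mul1r subrr.
by rewrite bA // bB // (negPf iNj) addr0.
Qed.

Lemma band_expg m A :
  (forall u : R, u \is a GRing.unit -> u ^+ m = 1) -> band 1 (A ^+ m)%g.
Proof.
move=> um i j; rewrite addn1 ltnS leq_eqVlt => /orP[/eqP/val_inj ->|ji].
  have /invertible_utrigP[_ /(_ i) /um <-] := valP A; rewrite eqxx.
  elim: m {um} => [|m IHm]; first by rewrite expg0 tri_mx1 mxE eqxx.
  have /invertible_utrigP[A0 _] := valP A.
  have /invertible_utrigP[Am0 _] := valP (A ^+ m)%g.
  rewrite expgS exprS tri_mxM mxE (bigD1 i) //= IHm big1 ?addr0 // => l lNi.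
  case: (ltngtP l i) => [li|il|/val_inj li].
  - by rewrite A0 ?mul0r.
  - by rewrite Am0 ?mulr0.
  - by rewrite li eqxx in lNi.
have /invertible_utrigP[-> //] := valP (A ^+ m)%g.
by rewrite -val_eqE /= gtn_eqF.
Qed.

Lemma tri_positive_generalized_identity m :
    (0 < m)%N -> (forall u : R, u \is a GRing.unit -> u ^+ m = 1) ->
  positive_generalized_identity 'T_n(R).
Proof.
move=> m_gt0 um.
have [w w_pos wb] :
    exists2 w : 'T_n(R) -> 'T_n(R), positive_word w & forall A, band n.+1 (w A).
  (* Width n + 1 covers every entry and is positive, so the induction can start at width 1 even if n
     = 0. *)
  elim: n.+1 (ltn0Sn n) => // -[_ _|k IHk _].
    exists (fun A => A ^+ m)%g => [|A]; first exact: positive_word_expg.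
    exact: band_expg.
  have [//|w w_pos wb] := IHk; exists ((fun A => A * A ^ sign_tri k.+1)%g \o w).
    exact: positive_word_comp (positive_word_conj2 _) w_pos.
  by move=> A; apply: band_step.
apply: positive_word_identity w_pos _ => A; apply/val_inj/matrixP=> i j.
rewrite wb ?mxE //.
by rewrite (leq_trans (ltn_ord j)) // (leq_trans (leqnSn n)) // leq_addl.
Qed.

Fact scalar_tri (u : R) :
  u \is a GRing.unit -> u%:M \in @invertible_utrig R n.
Proof.
move=> Uu; apply/invertible_utrigP; split=> [i j ji|i]; rewrite mxE ?eqxx //.
by rewrite -val_eqE /= gtn_eqF.
Qed.

(** Scalar matrices are central, so a positive word with [m] factors raises them to the power
    [m]. *)
Lemma tri_unit_expr :
    (0 < n)%N -> positive_generalized_identity 'T_n(R) ->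
  exists2 m, (0 < m)%N & forall u : R, u \is a GRing.unit -> u ^+ m = 1.
Proof.
move=> n_gt0 [m [m_gt0 [h hP]]]; exists m => // u Uu.
pose x := Triangular (scalar_tri Uu).
have xJ y : (x ^ y)%g = x.
  rewrite conjgE; apply: (mulgI y); rewrite mulKVg; apply: val_inj.
  by rewrite /= scalar_mxC.
have {hP} : (x ^+ m = 1)%g.
  by rewrite -(hP x); under eq_bigr do rewrite xJ; rewrite prodg_const card_ord.
have xX k : tri_mx (x ^+ k)%g = (u ^+ k)%:M.
  elim: k => [|k IHk]; first by rewrite expg0.
  by rewrite expgS tri_mxM IHk -scalar_mxM exprS.
move=> /(congr1 (@tri_mx _ _)); rewrite xX => /matrixP.
move=> /(_ (Ordinal n_gt0) (Ordinal n_gt0)).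
by rewrite !mxE eqxx.
Qed.

End Triangular.

(** * Additive extension of functions from G to ZG *)

Section LinearExtension.

Variables (gT : finGroupType) (abG : abelian [set: gT]).
Implicit Types a b : zgring abG.

(** [f] is arbitrary because one later use controls it only on the powers of a single element. *)
Definition zglift (f : gT -> algC) a : algC := \sum_g (a g)%:~R * f g.

Variable f : gT -> algC.

Lemma zgliftB a b : zglift f (a - b) = zglift f a - zglift f b.
Proof.
rewrite /zglift -sumrB; apply: eq_bigr => g _.
by rewrite /zgcoef !ffunE rmorphB mulrBl.
Qed.

HB.instance Definition _ :=
  GRing.isZmodMorphism.Build (zgring abG) algC (zglift f) zgliftB.

Lemma zglift_basis g : zglift f (zgbasis abG g) = f g.
Proof.
rewrite /zglift (bigD1 g) //= big1 => [|h /negPf hNg]; rewrite /zgcoef ffunE.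
  by rewrite eqxx mul1r addr0.
by rewrite hNg mul0r.
Qed.

Lemma zgliftM a b :
    {morph f : x y / (x * y)%g >-> x * y} ->
  zglift f (a * b) = zglift f a * zglift f b.
Proof.
move=> fM; rewrite [RHS]mulr_suml /zglift.
under eq_bigr => g _ do rewrite zgmulE rmorph_sum mulr_suml.
rewrite exchange_big; apply: eq_bigr => h _; rewrite mulr_sumr.
rewrite (reindex_inj (mulgI h)); apply: eq_bigr => k _.
by rewrite mulKg fM rmorphM mulrACA.
Qed.

Lemma zgbasisX g m : zgbasis abG g ^+ m = zgbasis abG (g ^+ m)%g.
Proof.
by elim: m => [|m IHm]; rewrite ?expg0 // exprS expgS IHm zgbasisM.
Qed.

End LinearExtension.

(** * Units of ZG when the exponent divides 4 or 6 *)

(** Such a z is a root of some z^2 - t z + 1 with t an integer, and dividing by z gives trace t; for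
    z = 1 and z = -1 the quadratic is a square. *)
Lemma root_of_unity46_trace_rat (z : algC) :
  (z ^+ 4 == 1) || (z ^+ 6 == 1) -> z + z^* \in Crat.
Proof.
move=> z46.
have nz : `|z| = 1.
  by case/orP: z46 => /eqP/(congr1 Num.norm); rewrite normrX normr1 => /eqP;
    rewrite pexpr_eq1 // => /eqP.
have zJ : z * z^* = 1 by rewrite -normCK nz expr1n.
have z0 : z != 0 by rewrite -normr_eq0 nz oner_eq0.
have tr (t : int) : z ^+ 2 - t%:~R * z + 1 == 0 -> z + z^* \in Crat.
  move=> zt; suff ->: z + z^* = t%:~R by rewrite rpred_int.
  apply/eqP; rewrite -subr_eq0 -(mulrI_eq0 _ (mulfI z0)).
  by rewrite mulrBr mulrDr zJ -expr2 addrAC [z * _]mulrC.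
have sq : z ^+ 2 - 1 == 0 -> z + z^* \in Crat.
  rewrite subr_sqr_1 mulf_eq0 => /orP[] z1.
    apply: (tr 2); have ->: z ^+ 2 - 2%:~R * z + 1 = (z - 1) ^+ 2 by ring.
    by rewrite (eqP z1) expr0n.
  apply: (tr (-2)); have ->: z ^+ 2 - (-2)%:~R * z + 1 = (z + 1) ^+ 2 by ring.
  by rewrite (eqP z1) expr0n.
case/orP: z46; rewrite -subr_eq0.
  have ->: z ^+ 4 - 1 = (z ^+ 2 - 1) * (z ^+ 2 - 0%:~R * z + 1) by ring.
  by rewrite mulf_eq0 => /orP[/sq | /tr].
have ->: z ^+ 6 - 1 = (z ^+ 2 - 1)
    * ((z ^+ 2 - 1%:~R * z + 1) * (z ^+ 2 - (-1)%:~R * z + 1)) by ring.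
by rewrite !mulf_eq0 => /or3P[/sq | /tr | /tr].
Qed.

Section SmallExponent.

Variables (gT : finGroupType) (abG : abelian [set: gT]).
Implicit Types a : zgring abG.

Let chi_lin (i : Iirr [set: gT]) : 'chi_i \is a linear_char.
Proof. exact/char_abelianP. Qed.

Let chiM i : {morph 'chi[[set: gT]]_i : x y / (x * y)%g >-> x * y}.
Proof. by move=> x y; rewrite lin_charM ?inE. Qed.

Lemma normCK_zglift i a :
  `|zglift 'chi[[set: gT]]_i a| ^+ 2
    = \sum_g \sum_h (a g * a h)%:~R * 'chi_i (g * h^-1)%g.
Proof.
rewrite normCK rmorph_sum mulr_suml; apply: eq_bigr => g _.
rewrite mulr_sumr; apply: eq_bigr => h _.
by rewrite rmorphM /= rmorph_int chiM lin_charV_conj ?inE // rmorphM mulrACA.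
Qed.

(** All degrees are 1, so the irreducible characters sum to the regular character, which kills the
    terms with g != h. *)
Lemma zglift_parseval a :
  \sum_i `|zglift 'chi[[set: gT]]_i a| ^+ 2 = #|gT|%:R * (\sum_g a g ^+ 2)%:~R.
Proof.
under eq_bigr => i _ do rewrite normCK_zglift.
rewrite exchange_big rmorph_sum mulr_sumr; apply: eq_bigr => g _ /=.
rewrite exchange_big /= (bigD1 g) //= [X in _ + X]big1 => [|h hNg].
  rewrite addr0 mulgV; under eq_bigr => i _ do rewrite lin_char1 // mulr1.
  rewrite sumr_const card_Iirr_abelian // cardsT -[LHS]mulr_natl.
  by rewrite expr2.
rewrite -mulr_sumr.
suff ->: \sum_i 'chi[[set: gT]]_i (g * h^-1)%g = 0 by rewrite mulr0.
have := cfRegE [set: gT] (g * h^-1)%g; rewrite cfReg_sum sum_cfunE.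
rewrite -eq_mulgV1 eq_sym (negPf hNg) mulr0n => reg0; rewrite -[RHS]reg0.
by apply: eq_bigr => i _; rewrite cfunE lin_char1 // mul1r.
Qed.

Hypothesis e46 : (exponent [set: gT] %| 4)%N || (exponent [set: gT] %| 6)%N.

Lemma normCK_zglift_nat i a : `|zglift 'chi[[set: gT]]_i a| ^+ 2 \is a Num.nat.
Proof.
rewrite natrEint exprn_ge0 ?andbT //; apply: Cint_rat_Aint; last first.
  rewrite normCK_zglift; do 2!apply: rpred_sum => ? _.
  by rewrite rpredM ?Aint_irr // rpred_int.
set t := _ ^+ 2.
(* As t is real, its expansion can be averaged with the conjugate one, which pairs each character
   value with its conjugate. *)
have -> : t = (t + t^* ) / 2.
  have ->: t^* = t by rewrite /t rmorphXn /= conj_normC.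
  by rewrite -[t + t]mulr2n -[t *+ 2]mulr_natr mulfK ?pnatr_eq0.
rewrite rpred_div ?rpred_nat // /t normCK_zglift rmorph_sum -big_split.
apply: rpred_sum => g _; rewrite rmorph_sum -big_split; apply: rpred_sum => h _.
rewrite /= [in X in _ + X]rmorphM /= rmorph_int -mulrDr rpredM ?rpred_int //.
apply: root_of_unity46_trace_rat; rewrite -!lin_charX ?inE //.
by case/orP: e46 => /exponentP->; rewrite ?inE ?lin_char1 ?eqxx ?orbT.
Qed.

Lemma zgring_unit_sum_sqr a : a \is a GRing.unit -> \sum_g a g ^+ 2 = 1.
Proof.
move=> Ua; have chi_a i : `|zglift 'chi[[set: gT]]_i a| ^+ 2 = 1.
  (* The values at [a] and at its inverse are natural numbers with product 1. *)
  have /natrP[m am] := normCK_zglift_nat i a.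
  have /natrP[k bk] := normCK_zglift_nat i a^-1.
  have /eqP : (m * k)%:R = 1 :> algC.
    rewrite natrM -am -bk -exprMn -normrM -(zgliftM _ _ (@chiM i)) mulrV //.
    by rewrite -zgbasis1 zglift_basis lin_char1 // normr1 expr1n.
  by rewrite pnatr_eq1 muln_eq1 => /andP[/eqP m1 _]; rewrite am m1.
have := zglift_parseval a; under eq_bigr do rewrite chi_a.
rewrite sumr_const card_Iirr_abelian // cardsT.
have gTn0 : #|gT|%:R != 0 :> algC.
  by rewrite pnatr_eq0 -lt0n; apply/card_gt0P; exists 1%g.
by move=> S; apply: (intr_inj (R := algC)); apply: (mulfI gTn0);
  rewrite -S mulr1.
Qed.

(** A single coefficient is nonzero and it is 1 or -1; squaring removes the sign. *)
Lemma zgring_sqr_trivial a :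
  \sum_g a g ^+ 2 = 1 -> exists g, a ^+ 2 = zgbasis abG (g ^+ 2)%g.
Proof.
move=> a1; have [g ag] : exists g, a g != 0.
  apply/existsP; apply: contra_eqT a1 => /existsPn a0.
  rewrite big1 // => g _; have := a0 g; rewrite negbK => /eqP->.
  by rewrite expr0n.
exists g; have rest_ge0 : 0 <= \sum_(h | h != g) a h ^+ 2.
  by apply: sumr_ge0 => h _; rewrite sqr_ge0.
move: a1; rewrite (bigD1 g) //= => a1.
have ag2 : a g ^+ 2 = 1.
  apply/eqP; rewrite eq_le -{1}a1 lerDl rest_ge0.
  by rewrite -gtz0_ge1 lt_def sqrf_eq0 ag sqr_ge0.
have a0 h : h != g -> a h = 0.
  move: a1; rewrite ag2 => /(canRL (addKr _)); rewrite addNr => a1.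
  move=> hNg; apply/eqP; rewrite -sqrf_eq0; apply/eqP.
  by apply: (psumr_eq0P _ a1) => // k _; rewrite sqr_ge0.
have -> : a = zgbasis abG g *~ a g.
  apply/ffunP=> h; rewrite ffunMzE ffunE.
  case: eqP => [->|/eqP/a0->]; first by rewrite -mulrzr mul1r intz.
  by rewrite mul0rz.
rewrite expr2 mulrzAl mulrzAr mulrzA_C -[a g * a g]expr2 ag2 mulr1z.
by rewrite zgbasisM.
Qed.

Lemma zgring_unit_expr a : a \is a GRing.unit -> a ^+ 24 = 1.
Proof.
move=> /zgring_unit_sum_sqr/zgring_sqr_trivial[g a2].
(* The factor 2 removes the sign, and 12 = lcm(4, 6) kills G. *)
rewrite -[24%N]/(2 * 12)%N exprM a2 zgbasisX -expgM mulnC expgM.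
suff -> : (g ^+ 12 = 1)%g by rewrite expg1n.
have e12 : (exponent [set: gT] %| 12)%N.
  by case/orP: e46 => /dvdn_trans->.
by have /exponentP-> := e12; rewrite ?inE.
Qed.

End SmallExponent.

(** * Geometric sums and Bass cyclic units *)

Definition geom (R : nzRingType) (x : R) (n : nat) : R := \sum_(i < n) x ^+ i.

Section GeometricSums.

Variables (R : comNzRingType) (x : R) (N : nat).

(** The product of (x^a - 1)/(x - 1) and (x^(ab) - 1)/(x^a - 1), without division. *)
Lemma geomM a b : geom x a * geom (x ^+ a) b = geom x (a * b).
Proof.
elim: b => [|b IHb]; first by rewrite muln0 /geom !big_ord0 mulr0.
rewrite [geom _ b.+1]big_ord_recr mulrDr IHb mulnS addnC /geom big_split_ord.
congr (_ + _); rewrite mulr_suml; apply: eq_bigr => i _.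
by rewrite -exprM -exprD addnC.
Qed.

Hypothesis xN1 : x ^+ N = 1.
Local Notation s := (geom x N).

Lemma expr_geom i : x ^+ i * s = s.
Proof.
elim: i => [|i IHi]; first by rewrite mul1r.
rewrite exprSr -mulrA; suff ->: x * s = s by [].
by apply/eqP; rewrite -subr_eq0 -[X in _ - X]mul1r -mulrBl -subrX1 xN1 subrr.
Qed.

Lemma geom_expr_geom i a : geom (x ^+ i) a * s = s *+ a.
Proof.
rewrite mulr_suml; under eq_bigr do rewrite -exprM expr_geom.
by rewrite sumr_const card_ord.
Qed.

Lemma exp_geom_expr_geom i a m : geom (x ^+ i) a ^+ m * s = s *+ (a ^ m).
Proof.
elim: m => [|m IHm]; first by rewrite mul1r.
by rewrite exprSr -mulrA geom_expr_geom mulrnAr IHm -mulrnA -expnSr.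
Qed.

Lemma geom_modn1 c : geom x (c * N).+1 = 1 + s *+ c.
Proof.
rewrite [LHS]big_ord_recr /= -/(geom x (c * N)) [(c * N)%N]mulnC -geomM.
rewrite exprM xN1 expr1n addrC; congr (_ + _).
rewrite /(geom 1 c).
by under eq_bigr do rewrite expr1n; rewrite sumr_const card_ord mulr_natr.
Qed.

Lemma geom_sqr : s * s = s *+ N.
Proof. by have := geom_expr_geom 1 N; rewrite expr1. Qed.

(** Since s^2 = N s, the elements 1 + k s are closed under products. *)
Lemma exp_geom_modn1 c m : exists k : int, (1 + s *+ c) ^+ m = 1 + s *~ k.
Proof.
have ss := geom_sqr.
elim: m => [|m [k IHm]]; first by exists 0; rewrite mulr0z addr0.
exists (k + c%:Z + N%:Z * k * c%:Z); rewrite exprSr IHm.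
rewrite -mulr_natr -[s *~ k]mulrzr.
transitivity (1 + s * (k%:~R + c%:R) + (s * s) * (k%:~R * c%:R)); first by ring.
by rewrite ss -mulr_natr -[s *~ _]mulrzr; ring.
Qed.

(** The correction by [q] is what makes the factor fix s: a^m s - q N s = s. *)
Lemma bass_mul_geom i a m q :
  (a ^ m = q * N + 1)%N -> (geom (x ^+ i) a ^+ m - s *+ q) * s = s.
Proof.
move=> am; rewrite mulrBl exp_geom_expr_geom am mulrnAl geom_sqr -mulrnA.
by rewrite mulrnDr mulr1n [(N * q)%N]mulnC addrC addKr.
Qed.

(* With [s] the sum of the powers of [x], the product of the two factors is
   [1] modulo [s], hence of the form [1 + k s]; as both factors act trivially on
   [s], comparing the actions on [s] gives [k = 0]. *)
Lemma bass_unit a b m c q r :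
    (0 < N)%N -> (forall k : int, s *~ k = 0 -> k = 0) ->
    (a * b = c * N + 1)%N -> (a ^ m = q * N + 1)%N -> (b ^ m = r * N + 1)%N ->
  (geom x a ^+ m - s *+ q) * (geom (x ^+ a) b ^+ m - s *+ r) = 1.
Proof.
move=> N_gt0 s_free ab am bm.
have us : (geom x a ^+ m - s *+ q) * s = s.
  by rewrite -{1}[x]expr1 bass_mul_geom.
have ws : (geom (x ^+ a) b ^+ m - s *+ r) * s = s by rewrite bass_mul_geom.
set u := _ - _ in us *; set w := _ - _ in ws *.
have [k uwE] : exists k : int, u * w = 1 + s *~ k.
  have [k kE] := exp_geom_modn1 c m.
  exists (k - r%:Z - q%:Z - N%:Z * q%:Z * r%:Z).
  have -> : u * w = (geom x a * geom (x ^+ a) b) ^+ m - u * s *+ r - w * s *+ q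
      - s * s *+ q *+ r.
    by rewrite exprMn /u /w; ring.
  rewrite us ws geom_sqr geomM ab addn1 geom_modn1 kE.
  by ring.
have k0 : k * N%:Z = 0.
  apply: s_free; have : (u * w) * s = s by rewrite -mulrA ws us.
  rewrite uwE mulrDl mul1r mulrzAl geom_sqr => /(canRL (addKr _)).
  by rewrite addNr pmulrn mulrzA_C mulrC.
have /eqP := k0; rewrite mulf_eq0 => /orP[/eqP k00|].
  by rewrite uwE k00 mulr0z addr0.
by rewrite eqz_nat => /eqP N0; rewrite N0 in N_gt0.
Qed.

End GeometricSums.

(** * A Bass unit of infinite order *)

(** On the unit circle the distance to 1 determines the real part, hence the point up to
    conjugation, which is inversion. *)
Lemma dist1_unit_circle (C : numClosedFieldType) (w z : C) :
  `|w| = 1 -> `|z| = 1 -> `|w - 1| = `|z - 1| -> w = z \/ w * z = 1.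
Proof.
move=> w1 z1 /(congr1 (fun t => t ^+ 2)); rewrite !normCK !rmorphB !rmorph1.
have wJ : w * w^* = 1 by rewrite -normCK w1 expr1n.
have zJ : z * z^* = 1 by rewrite -normCK z1 expr1n.
move=> wz; have : (w - z) * (w * z - 1) == 0.
  have -> : (w - z) * (w * z - 1) = w * z * ((z - 1) * (z^* - 1)
      - (w - 1) * (w^* - 1)) + (z * z^* - 1) * (w - w * z)
      + (w * w^* - 1) * (w * z - z) by ring.
  by rewrite wz wJ zJ !subrr !mul0r mulr0 !addr0.
by rewrite mulf_eq0 !subr_eq0 => /orP[] /eqP; [left | right].
Qed.

(** Otherwise |z^a - 1| = |z - 1|, so z^a is z or its inverse, against 1 < a < n - 1. *)
Lemma geom_prim_root_expr_neq1 (n a k : nat) (z : algC) :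
    n.-primitive_root z -> (1 < a)%N -> (a.+1 < n)%N -> (0 < k)%N ->
  geom z a ^+ k != 1.
Proof.
move=> z_prim a_gt1 an k_gt0; apply/eqP=> gk.
have n_gt1 : (1 < n)%N by lia.
have z1 : `|z| = 1.
  have /eqP := congr1 Num.norm (prim_expr_order z_prim).
  by rewrite normrX normr1 pexpr_eq1 ?(prim_order_gt0 z_prim) // => /eqP.
have g1 : `|geom z a| = 1.
  have /eqP := congr1 Num.norm gk.
  by rewrite normrX normr1 pexpr_eq1 // => /eqP.
have /dist1_unit_circle : `|z ^+ a - 1| = `|z - 1|.
  by rewrite subrX1 normrM -/(geom z a) g1 mulr1.
case=> //; first by rewrite normrX z1 expr1n.
  move/eqP; rewrite -{2}[z]expr1 (eq_prim_root_expr z_prim) !modn_small //; lia.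
by move/eqP; rewrite -exprSr -(prim_order_dvd z_prim) gtnNdvd.
Qed.

(** The witness is 2 for odd n; for n = 2m it is m - 2 or m - 1, whichever is odd. *)
Lemma coprime_between n :
    (0 < n)%N -> n \notin [:: 1; 2; 3; 4; 6]%N ->
  exists a, [/\ coprime a n, (1 < a)%N & (a.+1 < n)%N].
Proof.
move=> n_gt0; rewrite !inE => nN.
have [n2|n2] := boolP (odd n).
  exists 2%N; split=> //; [by rewrite coprime2n | lia].
have nE : n = (n./2 * 2)%N by rewrite muln2 even_halfK.
set m := n./2 in nE; have m_gt3 : (3 < m)%N by lia.
have [m2|m2] := boolP (odd m).
  have a2 : odd (m - 2) by rewrite oddB ?m2 //; lia.
  exists (m - 2)%N; rewrite nE coprimeMr coprimen2 a2 andbT; split; [|lia|lia].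
  have {2}-> : m = (m - 2 + 2)%N by lia.
  by rewrite /coprime gcdnDl -/(coprime _ _) coprimen2.
have a2 : odd (m - 1) by rewrite oddB ?(negPf m2) //; lia.
exists (m - 1)%N; rewrite nE coprimeMr coprimen2 a2 andbT; split; [|lia|lia].
have {2}-> : m = (m - 1 + 1)%N by lia.
by rewrite /coprime gcdnDl -/(coprime _ _) coprimen1.
Qed.

Lemma horner_map_geom (R : comNzRingType) (x : R) n :
  (map_poly intr (geom 'X n : {poly int})).[x] = geom x n.
Proof.
rewrite rmorph_sum horner_sum; apply: eq_bigr => i _.
by rewrite /= map_polyXn hornerXn.
Qed.

(** Additivity suffices on integer polynomials in [g], so [f] need not be multiplicative on G. *)
Lemma zglift_horner (gT : finGroupType) (abG : abelian [set: gT])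
    (f : gT -> algC) (g : gT) (z : algC) (p : {poly int}) :
    (forall i, f (g ^+ i)%g = z ^+ i) ->
  zglift f (map_poly intr p).[zgbasis abG g] = (map_poly intr p).[z].
Proof.
move=> fX; rewrite !(horner_coef_wide _ (size_poly _ _)) raddf_sum.
apply: eq_bigr => i _; rewrite zgbasisX !coef_map /= mulrzl.
by rewrite raddfMz /= zglift_basis fX -mulrzl.
Qed.

Lemma expg_prim_root (gT : finGroupType) (g : gT) (z : algC) :
    #[g]%g.-primitive_root z ->
  exists f : gT -> algC, forall i, f (g ^+ i)%g = z ^+ i.
Proof.
move=> z_prim.
(* The value 0 off the subgroup generated by [g] is a default; no character of G has to be
   constructed. *)
exists (fun h => if [pick i : 'I_(#[g]%g) | (g ^+ i == h)%g] is Some i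
                 then z ^+ i else 0) => i.
case: pickP => [j|/(_ (Ordinal (ltn_pmod i (order_gt0 g))))/=].
  by rewrite eq_expg_mod_order -(eq_prim_root_expr z_prim) => /eqP.
by rewrite expg_mod_order eqxx.
Qed.

Lemma zgring_unit_infinite_order (gT : finGroupType) (abG : abelian [set: gT]) :
    exponent [set: gT] \notin [:: 1; 2; 3; 4; 6]%N ->
  exists2 u : zgring abG,
    u \is a GRing.unit & forall k, (0 < k)%N -> u ^+ k != 1.
Proof.
have [g _ ->] := exponent_witness (abelian_nil abG).
set N := #[g]%g => N_notin; have N_gt0 : (0 < N)%N by apply: order_gt0.
have [a [aN a_gt1 a_ltN]] := coprime_between N_gt0 N_notin.
pose m := totient N; have m_gt0 : (0 < m)%N by rewrite totient_gt0.
have N_gt1 : (1 < N)%N by lia.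
have euler e : (a ^ (m * e) = (a ^ (m * e) %/ N) * N + 1)%N.
  rewrite {1}(divn_eq (a ^ (m * e)) N) expnM -modnXm Euler_exp_totient //.
  by rewrite modnXm exp1n modn_small.
set q := fun e => (a ^ (m * e) %/ N)%N in euler.
(* An inverse of a modulo N: a b = a^m and b^m = a^(m (m - 1)), so [euler] provides all three
   congruences. *)
pose b := (a ^ m.-1)%N.
pose x := zgbasis abG g; have xN1 : x ^+ N = 1 by rewrite zgbasisX expg_order.
have s_free (k : int) : geom x N *~ k = 0 -> k = 0.
  (* The augmentation sends [geom x N] to N, which is nonzero. *)
  move=> /(congr1 (zglift (fun=> 1))); rewrite raddfMz raddf_sum raddf0.
  under eq_bigr do rewrite zgbasisX /= zglift_basis.
  rewrite sumr_const card_ord => /eqP; rewrite pmulrn mulrzA_C intr_eq0.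
  by rewrite mulf_eq0 eqz_nat (gtn_eqF N_gt0) orbF => /eqP.
have := bass_unit xN1 N_gt0 s_free (a := a) (b := b) (m := m) (c := q 1%N)
                  (q := q 1%N) (r := q m.-1).
rewrite -expnS prednK // -expnM [(m.-1 * m)%N]mulnC -!euler muln1.
move=> /(_ erefl erefl erefl).
set u := geom x a ^+ m - _; set w := _ - _ => uw1; exists u.
  by apply/unitrPr; exists w.
move=> k k_gt0; apply/eqP=> uk1.
have [z z_prim] := C_prim_root_exists N_gt0.
have [f fX] := expg_prim_root z_prim.
(* u is the value of [p] at [x], so u^k = 1 can be transported to [z] through [p ^+ k]. *)
pose p : {poly int} := geom 'X a ^+ m - geom 'X N *+ q 1%N.
have pE (R : comNzRingType) (y : R) :
    (map_poly intr (p ^+ k)).[y] = (geom y a ^+ m - geom y N *+ q 1%N) ^+ k.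
  rewrite rmorphXn horner_exp rmorphB hornerD hornerN rmorphMn hornerMn.
  by rewrite rmorphXn horner_exp /= !horner_map_geom.
have := zglift_horner abG (p ^+ k) fX; rewrite !pE uk1 -zgbasis1 zglift_basis.
(* The correction term of the Bass unit vanishes at [z]. *)
have -> : geom z N = 0.
  apply/eqP; have /eqP := subrX1 z N; rewrite prim_expr_order // subrr eq_sym.
  rewrite mulf_eq0 subr_eq0 -[z]expr1 -(prim_order_dvd z_prim) dvdn1.
  by rewrite (gtn_eqF N_gt1).
rewrite -(expg0 g) fX mul0rn subr0 -exprM => /esym/eqP; apply/negP.
by apply: (geom_prim_root_expr_neq1 z_prim); rewrite ?muln_gt0 ?m_gt0.
Qed.

(** * Criterion on the exponent of G *)

Theorem mainTheorem9 (gT : finGroupType) (abG : abelian [set: gT]) (n : nat)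
    (n_gt0 : (1 <= n)%N) :
  positive_generalized_identity 'T_n(zgring abG) <->
  exponent [set: gT] \in [:: 1; 2; 3; 4; 6]%N.
Proof.
split=> [/(tri_unit_expr n_gt0)[m m_gt0 um] | e_small].
  apply: contraT => /(zgring_unit_infinite_order abG)[u Uu /(_ m m_gt0)].
  by rewrite um ?eqxx.
apply: (@tri_positive_generalized_identity _ _ 24) => // u.
apply: zgring_unit_expr.
by move: e_small; rewrite !inE => /or4P[|||/orP[]] /eqP->.
Qed.
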